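(* Let $q\ge 3$ be a power of a prime $p$. The DGZ curve has no $\mathbb{F}_q$-rational points; that is, no point of $PG(2,\mathbb{F}_q)$ lies on it.
   Context: Put $D_1(x,y,z)=\begin{vmatrix} x & x^q & x^{q^3}\\ y & y^q & y^{q^3}\\ z & z^q & z^{q^3}\end{vmatrix}$, $D_2(x,y,z)=\begin{vmatrix} x & x^q & x^{q^2}\\ y & y^q & y^{q^2}\\ z & z^q & z^{q^2}\end{vmatrix}$ and $F=D_1/D_2$, which is a homogeneous polynomial of degree $q^3-q^2$ over $\mathbb{F}_q$. The DGZ curve is the plane curve over $\overline{\mathbb{F}}_q$ with equation $F(x,y,z)=0$. *)

(* Defs.v *)
From mathcomp Require Import all_boot all_order all_algebra all_field.
From mathcomp Require Import mpoly ring.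

Set Implicit Arguments.
Unset Strict Implicit.
Unset Printing Implicit Defensive.

Import GRing.Theory.
Local Open Scope ring_scope.

(* Here q = #|K|, and the three variables x, y, z are 'X_0, 'X_1, 'X_2. *)
Definition D1 (K : finFieldType) : {mpoly K[3]} :=
  \det (\matrix_(i < 3, j < 3) 'X_i ^+ (#|K| ^ nth 0 [:: 0; 1; 3] j)%N).

Definition D2 (K : finFieldType) : {mpoly K[3]} :=
  \det (\matrix_(i < 3, j < 3) 'X_i ^+ (#|K| ^ nth 0 [:: 0; 1; 2] j)%N).

Lemma det_mx33 (R : comPzRingType) (A : 'M[R]_3) :
  let a (i j : nat) := A (inord i) (inord j) in
  \det A = a 0%N 0%N * (a 1%N 1%N * a 2%N 2%N - a 1%N 2%N * a 2%N 1%N)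
         - a 0%N 1%N * (a 1%N 0%N * a 2%N 2%N - a 1%N 2%N * a 2%N 0%N)
         + a 0%N 2%N * (a 1%N 0%N * a 2%N 1%N - a 1%N 1%N * a 2%N 0%N).
Proof.
move=> a; have aE i j : A i j = a i j by rewrite /a !inord_val.
rewrite (expand_det_row _ ord0) !big_ord_recl big_ord0 /cofactor.
rewrite !(expand_det_row _ ord0) !big_ord_recl !big_ord0 /cofactor !det_mx11.
rewrite !mxE !aE /= /bump /=.
by rewrite !(expr0, expr1, addn0, add0n, addn1) /=; ring.
Qed.

Lemma cramer33 (R : comPzRingType) (n : nat) (c2 c1 c0 : R) (v : 'I_3 -> R) :
  (forall i, v i ^+ (n ^ 3) =
     c2 * v i ^+ (n ^ 2) + c1 * v i ^+ (n ^ 1) + c0 * v i ^+ (n ^ 0)) ->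
  \det (\matrix_(i < 3, j < 3) v i ^+ (n ^ nth 0 [:: 0; 1; 3] j)%N) =
  c2 * \det (\matrix_(i < 3, j < 3) v i ^+ (n ^ nth 0 [:: 0; 1; 2] j)%N).
Proof.
move=> vE; rewrite !det_mx33 !mxE !inordK //= !vE.
by ring.
Qed.

Lemma exprBn_card (K : finFieldType) (u v : {mpoly K[3]}) :
  (u - v) ^+ #|K| = u ^+ #|K| - v ^+ #|K|.
Proof.
have [p pr_p chK] := finPcharP K.
rewrite (card_pprimeChar chK).
elim: (logn _ _) => [|n IHn]; first by rewrite !expr1.
rewrite expnSr !exprM IHn.
rewrite -(pchar_lalg {mpoly K[3]}) in chK.
by rewrite -!(pFrobenius_autE chK) rmorphB.
Qed.

Lemma D2_neq0 (K : finFieldType) : D2 K != 0.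
Proof.
have q_gt1 : (1 < #|K|)%N by apply: finNzRing_gt1.
pose m := (U_(inord 0) *+ 1 + U_(inord 1) *+ #|K| + U_(inord 2) *+ (#|K| ^ 2))%MM
  : 'X_{1..3}.
suff: (D2 K)@_m != 0 by apply: contraNneq => ->; rewrite mcoeff0.
rewrite /D2 det_mx33 !mxE !inordK //= !mulrBr !mpolyXn -!mpolyXD.
rewrite !(mcoeffB, mcoeffD, mcoeffX).
have E e0 e1 e2 :
    ((U_(inord 0) *+ e0 + (U_(inord 1) *+ e1 + U_(inord 2) *+ e2))%MM == m) =
    [&& e0 == 1, e1 == #|K| & e2 == #|K| ^ 2]%N.
  apply/eqP/and3P => [mE|[/eqP-> /eqP-> /eqP->]]; last by rewrite mulm1n addmA.
  split; [move: (congr1 (fun u : 'X_{1..3} => u (inord 0)) mE)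
         |move: (congr1 (fun u : 'X_{1..3} => u (inord 1)) mE)
         |move: (congr1 (fun u : 'X_{1..3} => u (inord 2)) mE)];
    rewrite /m !mnmDE !mulmnE !mnm1E -!val_eqE /= !inordK //=;
    by rewrite !(mul0n, mul1n, addn0, add0n) => ->.
have q1 : (#|K| == 1)%N = false by rewrite gtn_eqF.
have qq1 : (#|K| ^ 2 == 1)%N = false by rewrite gtn_eqF // -(exp1n 2) ltn_exp2r.
have qq : (#|K| ^ 2 == #|K|)%N = false.
  by rewrite gtn_eqF // -{1}(expn1 #|K|) ltn_exp2l.
rewrite !E expn0 expn1 !eqxx q1 qq1 qq /= !subr0 !addr0.
by rewrite oner_neq0.
Qed.

(* Iterating P |-> P^q - P(v)^(q-1) P from P = T for v = x, y, z yields a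
   q-polynomial T^(q^3) - c2 T^(q^2) - c1 T^q - c0 T vanishing at x, y, z;
   hence D1 = c2 D2. *)
Lemma D2_dvd_D1 (K : finFieldType) :
  exists F : {mpoly K[3]}, F * D2 K == D1 K.
Proof.
set q := #|K|; have q_gt0 : (0 < q)%N by apply: ltnW; apply: finNzRing_gt1.
pose x i : {mpoly K[3]} := 'X_i.
pose a := x (inord 0) ^+ q.-1.
pose P1 t := t ^+ q - a * t.
pose b := P1 (x (inord 1)) ^+ q.-1.
pose P2 t := P1 t ^+ q - b * P1 t.
pose c := P2 (x (inord 2)) ^+ q.-1.
pose P3 t := P2 t ^+ q - c * P2 t.
have killed u : u ^+ q - u ^+ q.-1 * u = 0 :> {mpoly K[3]}.
  by rewrite -exprSr prednK ?subrr.
have frobB (u v : {mpoly K[3]}) : (u - v) ^+ q = u ^+ q - v ^+ q.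
  exact: exprBn_card.
have frobD (u v : {mpoly K[3]}) : (u + v) ^+ q = u ^+ q + v ^+ q.
  by rewrite -[u in RHS](addrK v) frobB subrK.
have x0n : (0 : {mpoly K[3]}) ^+ q = 0 by rewrite expr0n eqn0Ngt q_gt0.
have P3x i : P3 (x i) = 0.
  have: i \in [:: inord 0; inord 1; inord 2].
    by rewrite !inE -!val_eqE /= !inordK //; case: i => [[|[|[|]]]].
  rewrite !inE => /or3P[] /eqP->.
  - have P1x : P1 (x (inord 0)) = 0 by apply: killed.
    by rewrite /P3 /P2 P1x !(x0n, mulr0, subrr).
  - have P2x : P2 (x (inord 1)) = 0 by apply: killed.
    by rewrite /P3 P2x !(x0n, mulr0, subrr).
  - exact: killed.
have P3E t : P3 t = t ^+ (q ^ 3) - ((a ^+ q + b) ^+ q + c) * t ^+ (q ^ 2)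
    + ((a * b) ^+ q + c * (a ^+ q + b)) * t ^+ (q ^ 1) - (c * a * b) * t ^+ (q ^ 0).
  have P2E : P2 t = t ^+ q ^+ q - (a ^+ q + b) * t ^+ q + a * b * t.
    by rewrite /P2 /P1 frobB exprMn; ring.
  rewrite /P3 P2E frobD frobB !exprMn !frobD.
  rewrite !expnS expn0 muln1 !exprM expr1.
  by ring.
exists ((a ^+ q + b) ^+ q + c); apply/eqP; symmetry.
apply: (@cramer33 _ q _ (- ((a * b) ^+ q + c * (a ^+ q + b))) (c * a * b)) => i.
apply/eqP; rewrite -subr_eq0 -[X in _ == X](P3x i) P3E; apply/eqP.
by rewrite /x; ring.
Qed.

(* The polynomial D1 / D2; the quotient is unique since D2 != 0. *)
Definition DGZ_poly (K : finFieldType) : {mpoly K[3]} := xchoose (D2_dvd_D1 K).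

Lemma DGZ_polyE (K : finFieldType) : DGZ_poly K * D2 K = D1 K.
Proof. exact/eqP/(xchooseP (D2_dvd_D1 K)). Qed.

(* Points of PG(2, F) are the lines through the origin of F^3. *)
Definition PG2 (F : fieldType) := {P : {vspace 'rV[F]_3} | \dim P == 1%N}.

(* P = (x : y : z) with F(x, y, z) = 0; as F is homogeneous, the choice of the
   homogeneous coordinates v = (x, y, z) is immaterial. *)
Definition on_DGZ_curve (K : finFieldType) (L : fieldType)
    (iota : {rmorphism K -> L}) (P : PG2 L) : Prop :=
  exists v : 'rV[L]_3, [/\ v != 0, v \in val P &
    (map_mpoly iota (DGZ_poly K)).@[fun i => v 0 i] = 0].

(* P is the image of a point Q of PG(2, K) under the embedding iota. *)
Definition rational_point (K L : fieldType) (iota : {rmorphism K -> L})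
    (P : PG2 L) : Prop :=
  exists Q : PG2 K,
    forall w : 'rV[K]_3, w \in val Q -> map_mx iota w \in val P.

(* Main.v *)
(* F is the coefficient of T^(q^2), up to sign, in the product of the T - l over
   all F_q-combinations l of x, y, z.  Building this q-polynomial by killing x, y
   and z one after the other gives a closed form of F.  At a nonzero point
   proportional to a rational one, whose coordinates satisfy
   v_i^q v_j = v_j^q v_i, killing the first nonzero coordinate kills the others
   as well, and F reduces to a single power of that coordinate. *)
Require Import Defs.
From mathcomp Require Import all_boot all_order all_algebra all_field.
From mathcomp Require Import mpoly ring.

Import GRing.Theory.
Local Open Scope ring_scope.

(** Over a domain containing F_q and for [x != 0], this is the product of the [t - l * x] with l in
    F_q. *)
Definition kill1 {R : pzRingType} (q : nat) (x t : R) : R :=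
  t ^+ q - x ^+ q.-1 * t.

Definition kill2 {R : pzRingType} (q : nat) (x y t : R) : R :=
  kill1 q (kill1 q x y) (kill1 q x t).

Definition kill3 {R : pzRingType} (q : nat) (x y z t : R) : R :=
  kill1 q (kill2 q x y z) (kill2 q x y t).

(** For variables x, y, z over F_q, this is the Dickson invariant of GL_3(F_q) of degree q^3 -
    q^2. *)
Definition dickson {R : pzRingType} (q : nat) (x y z : R) : R :=
  ((x ^+ q.-1) ^+ q + kill1 q x y ^+ q.-1) ^+ q + kill2 q x y z ^+ q.-1.

Lemma rmorph_dickson (R S : pzRingType) (f : {rmorphism R -> S}) (q : nat)
    (x y z : R) :
  f (dickson q x y z) = dickson q (f x) (f y) (f z).
Proof.
have fk u t : f (kill1 q u t) = kill1 q (f u) (f t).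
  by rewrite /kill1 rmorphB rmorphM !rmorphXn.
by rewrite /dickson /kill2 rmorphD !rmorphXn rmorphD !rmorphXn !fk.
Qed.

Lemma kill1xx (R : pzRingType) (q : nat) (x : R) : (0 < q)%N -> kill1 q x x = 0.
Proof. by move=> q_gt0; rewrite /kill1 -exprSr prednK ?subrr. Qed.

Lemma kill10 (R : pzRingType) (q : nat) (x : R) : (0 < q)%N -> kill1 q x 0 = 0.
Proof. by move=> q_gt0; rewrite /kill1 mulr0 subr0 expr0n eqn0Ngt q_gt0. Qed.

(** Multiplying [kill1 q x t] by [x], which cancels in a domain, gives [t ^+ q * x - x ^+ q * t]. *)
Lemma kill1_eq0 (R : idomainType) (q : nat) (x t : R) :
  (0 < q)%N -> x != 0 -> t ^+ q * x = x ^+ q * t -> kill1 q x t = 0.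
Proof.
move=> q_gt0 x0 tx; apply: (mulIf x0).
by rewrite /kill1 mulrBl tx mulrAC -exprSr prednK // subrr mul0r.
Qed.

Lemma dickson_neq0 (R : idomainType) (q : nat) (x y z : R) : (1 < q)%N ->
    y ^+ q * x = x ^+ q * y -> z ^+ q * x = x ^+ q * z ->
    z ^+ q * y = y ^+ q * z ->
  [|| x != 0, y != 0 | z != 0] -> dickson q x y z != 0.
Proof.
move=> q_gt1 yx zx zy; have q_gt0 := ltnW q_gt1.
(* Here [1 < q] matters: for q = 1 this power would be [0 ^+ 0 = 1]. *)
have exp0 : (0 : R) ^+ q.-1 = 0 by rewrite expr0n -subn1 subn_eq0 leqNgt q_gt1.
have exp0q : (0 : R) ^+ q = 0 by rewrite expr0n eqn0Ngt q_gt0.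
have [->|x0 _] := eqVneq x 0; last first.
  rewrite /dickson /kill2 (kill1_eq0 _ _ _ _ q_gt0 x0 yx).
  by rewrite (kill1_eq0 _ _ _ _ q_gt0 x0 zx) kill10 // exp0 !addr0 !expf_neq0.
(* Killing 0 is just raising to the q-th power, so a leading zero coordinate passes the next one on
   as a q-th power. *)
have kill1_0 (t : R) : kill1 q 0 t = t ^+ q by rewrite /kill1 exp0 mul0r subr0.
have [->|y0 _] := eqVneq y 0 => /=.
  move=> z0; rewrite /dickson /kill2 !kill1_0 exp0q kill1_0 exp0 exp0q addr0.
  by rewrite exp0q add0r !expf_neq0.
rewrite /dickson /kill2 !kill1_0 (kill1_eq0 _ _ (y ^+ q)) ?expf_neq0 //.
  by rewrite exp0 exp0q add0r addr0 !expf_neq0.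
by rewrite -!exprMn zy.
Qed.

(** The q-th power map is additive on [{mpoly K[3]}], so composing the three killings leaves only
    the powers t^(q^i). *)
Lemma kill3E (K : finFieldType) (x y z t : {mpoly K[3]}) :
  let q := #|K| in
  kill3 q x y z t = t ^+ (q ^ 3) - dickson q x y z * t ^+ (q ^ 2)
    + ((x ^+ q.-1 * kill1 q x y ^+ q.-1) ^+ q
       + kill2 q x y z ^+ q.-1 * ((x ^+ q.-1) ^+ q + kill1 q x y ^+ q.-1))
      * t ^+ (q ^ 1)
    - kill2 q x y z ^+ q.-1 * x ^+ q.-1 * kill1 q x y ^+ q.-1 * t ^+ (q ^ 0).
Proof.
move=> q; rewrite /dickson.
have frobB (u v : {mpoly K[3]}) : (u - v) ^+ q = u ^+ q - v ^+ q.
  exact: exprBn_card.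
have frobD (u v : {mpoly K[3]}) : (u + v) ^+ q = u ^+ q + v ^+ q.
  by rewrite -[u in RHS](addrK v) frobB subrK.
rewrite {1}/kill3 [X in X = _]/kill1.
(* Naming each coefficient before the next unfolding keeps it an atom for [ring]. *)
set c := kill2 q x y z ^+ q.-1.
rewrite /kill2 [kill1 q (kill1 q x y) _]/kill1.
set b := kill1 q x y ^+ q.-1.
rewrite /kill1; set a := x ^+ q.-1.
rewrite !expnS expn0 muln1 !exprM expr1.
by rewrite !(frobB, frobD, exprMn); ring.
Qed.

Lemma DGZ_poly_dickson (K : finFieldType) :
  DGZ_poly K = dickson #|K| 'X_(inord 0) 'X_(inord 1) 'X_(inord 2).
Proof.
set q := #|K|; set x := 'X_(inord 0); set y := 'X_(inord 1); set z := 'X_(inord 2).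
have q_gt0 : (0 < q)%N by apply: ltnW; apply: finNzRing_gt1.
apply: (mulIf (D2_neq0 K)); rewrite DGZ_polyE.
(* The scalars are the coefficients of t^q and t in [kill3E], negated because these terms change
   sides. *)
apply: (@cramer33 _ q _
  (- ((x ^+ q.-1 * kill1 q x y ^+ q.-1) ^+ q
      + kill2 q x y z ^+ q.-1 * ((x ^+ q.-1) ^+ q + kill1 q x y ^+ q.-1)))
  (kill2 q x y z ^+ q.-1 * x ^+ q.-1 * kill1 q x y ^+ q.-1)) => i.
have: kill3 q x y z 'X_i = 0.
  have: i \in [:: inord 0; inord 1; inord 2].
    by rewrite !inE -!val_eqE /= !inordK //; case: i => [[|[|[|]]]].
  rewrite !inE => /or3P[] /eqP->.
  - by rewrite /kill3 /kill2 kill1xx // !kill10.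
  - by rewrite /kill3 {2}/kill2 kill1xx // kill10.
  - exact: kill1xx.
rewrite kill3E -/q => E; apply/eqP; rewrite -subr_eq0 -[X in _ == X]E.
by apply/eqP; ring.
Qed.

Theorem proposition4p3 (p h q : nat) (K : finFieldType) (L : closedFieldType)
    (iota : {rmorphism K -> L}) :
  prime p -> (0 < h)%N -> q = (p ^ h)%N -> (3 <= q)%N -> #|K| = q ->
  integralRange iota ->
  ~ exists P : PG2 L, on_DGZ_curve iota P /\ rational_point iota P.
Proof.
move=> _ _ _ _ _ _ [[P /= dimP] [[v [v0 vP Fv0]] [[Q /= dimQ] QP]]].
have q_gt1 : (1 < #|K|)%N by apply: finNzRing_gt1.
have w0 : vpick Q != 0 by rewrite vpick0 -dimv_eq0 (eqP dimQ).
have /QP /= := memv_pick Q; move: (vpick Q) w0 => w w0 wP.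
(* [P] has dimension 1, so the image of the nonzero rational vector [w] spans it. *)
have [k vE] : exists k, v = k *: map_mx iota w.
  have iw0 : map_mx iota w != 0 by rewrite map_mx_eq0.
  apply/vlineP; suff -> : (<[map_mx iota w]> = P)%VS by [].
  by apply/eqP; rewrite eqEdim -memvE wP dim_vline iw0 (eqP dimP).
(* The entries of [w] are fixed by the q-th power, so both sides are k^(q+1) times the images of the
   i-th and j-th entries. *)
have frob i j : v 0 i ^+ #|K| * v 0 j = v 0 j ^+ #|K| * v 0 i.
  by rewrite vE !mxE !exprMn -!rmorphXn !expf_card; ring.
(* Coefficient change and evaluation are ring morphisms, so the closed form is evaluated by
   substituting the coordinates of [v]. *)
move: Fv0; rewrite /= DGZ_poly_dickson !rmorph_dickson /= !map_mpolyX !mevalXU.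
apply/eqP/dickson_neq0 => //; apply: contraNT v0.
rewrite !negb_or !negbK => /and3P[/eqP v00 /eqP v01 /eqP v02].
apply/eqP/rowP=> i; rewrite mxE -[i]inord_val.
by case: i => [[|[|[|]]]].
Qed.
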